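(* Let $\alpha,\beta\geq 1$ be natural numbers, let $p$ be a prime number, and let $n\geq 2$ be an integer with prime factorization $n=\prod_{i=1}^r p_i^{a_i}$, where $p_1,\dots,p_r$ are distinct primes and $a_i$ are positive integers, such that $\gcd(n,p)=1$. Then: i) If $\alpha\geq\beta\geq\Omega(n)e^{-H(n)}$, then $H(np^\alpha)\leq H(np^\beta)$. ii) If $\beta\leq\alpha\leq\Omega(n)e^{-H(n)}$, then $H(np^\alpha)\geq H(np^\beta)$.
   Context: $\log$ is the natural logarithm. For an integer $N=p_1^{\alpha_1}\cdots p_r^{\alpha_r}\geq 2$ (distinct primes $p_i$, exponents $\alpha_i\geq 1$), $\Omega(N)=\alpha_1+\dots+\alpha_r$ and the entropy of $N$ is $$H(N)=-\sum_{i=1}^r\frac{\alpha_i}{\Omega(N)}\log\frac{\alpha_i}{\Omega(N)}.$$ *)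

(* Defs.v *)
From mathcomp Require Import all_boot all_order all_algebra.
From mathcomp Require Import reals sequences exp.

Set Implicit Arguments.
Unset Strict Implicit.
Unset Printing Implicit Defensive.

Import Order.TTheory GRing.Theory Num.Theory.

Local Open Scope ring_scope.

(* Primes are counted with multiplicity. *)
Definition bigOmega (n : nat) : nat := (\sum_(p <- primes n) logn p n)%N.

(* Meaningful for n >= 2; for n <= 1 the sum is empty and the value is 0. *)
Definition entropy (R : realType) (n : nat) : R :=
  - \sum_(p <- primes n)
      ((logn p n)%:R / (bigOmega n)%:R) * ln ((logn p n)%:R / (bigOmega n)%:R).

(* Main.v *)
Require Import Defs.
From mathcomp Require Import all_boot all_order all_algebra.
From mathcomp Require Import reals sequences exp.
From mathcomp Require Import ring lra.

Set Implicit Arguments.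
Unset Strict Implicit.
Unset Printing Implicit Defensive.

Import Order.TTheory GRing.Theory Num.Theory.

Local Open Scope ring_scope.

(** Put [W = Omega n] and [L = (\sum a_i ln a_i) / W], so that
    [W e^(- H n) = e^L] and [H (n p^x) = h x], where
    [h x = ln (W + x) - (W L + x ln x) / (W + x)].  Gibbs' inequality for the
    two-point distributions proportional to [(W, x)] and [(W, y)] gives
    [h x - h y <= (W / (W + x) - W / (W + y)) (ln y - L)], without derivatives.
    The first factor has the sign of [y - x], so both monotonicity claims follow
    by taking for [y] the exponent adjacent to the threshold [e^L]. *)

(** Apply [ln t <= t - 1] to the two ratios of the distribution proportional to [(w, y)] by that
    proportional to [(w, x)], then add with weights [w] and [x]. *)
Lemma gibbs2 (R : realType) (w x y : R) : 0 < w -> 0 < x -> 0 < y ->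
  (w + x) * (ln (w + x) - ln (w + y)) <= x * (ln x - ln y).
Proof.
move=> w0 x0 y0.
have wx0 : 0 < w + x by exact: addr_gt0.
have wy0 : 0 < w + y by exact: addr_gt0.
have Ew : ln ((w + x) / (w + y)) = ln (w + x) - ln (w + y) by rewrite ln_div.
have Ex : ln ((w + x) / (w + y) * (y / x))
    = ln (w + x) - ln (w + y) + (ln y - ln x).
  by rewrite lnM ?posrE ?divr_gt0// !ln_div.
have ln_le (t : R) : 0 < t -> ln t <= t - 1.
  by move=> t0; have := @le_ln1Dx R (t - 1); rewrite [1 + _]addrC subrK; apply; lra.
have Iw : w * ln ((w + x) / (w + y)) <= w * ((w + x) / (w + y) - 1).
  by rewrite ler_pM2l// ln_le// divr_gt0.
have Ix : x * ln ((w + x) / (w + y) * (y / x))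
    <= x * ((w + x) / (w + y) * (y / x) - 1).
  by rewrite ler_pM2l// ln_le// mulr_gt0// divr_gt0.
(* The weighted upper bounds total [(w + y) * (w + x) / (w + y) - (w + x)], since both distributions
   have mass 1. *)
have E0 : w * ((w + x) / (w + y) - 1) + x * ((w + x) / (w + y) * (y / x) - 1) = 0.
  by field; rewrite !gt_eqF.
rewrite Ew in Iw; rewrite Ex in Ix.
lra.
Qed.

(** The function [h], with [W], [L] and the exponent as free reals. *)
Definition adjoined_entropy (R : realType) (w l x : R) : R :=
  ln (w + x) - (w * l + x * ln x) / (w + x).

Lemma adjoined_entropy_sub (R : realType) (w l x y : R) :
  0 < w -> 0 < x -> 0 < y ->
  adjoined_entropy w l x - adjoined_entropy w l y
    <= (w / (w + x) - w / (w + y)) * (ln y - l).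
Proof.
move=> w0 x0 y0.
have wx0 : 0 < w + x by exact: addr_gt0.
have wy0 : 0 < w + y by exact: addr_gt0.
rewrite -subr_ge0 /adjoined_entropy.
set D := (X in 0 <= X).
(* The terms in [l] cancel, and the coefficient of [ln y] collapses to [- x / (w + x)]. What remains
   is the gap in Gibbs' inequality, divided by [w + x]. *)
have -> : D = (x * (ln x - ln y)
    - (w + x) * (ln (w + x) - ln (w + y))) / (w + x).
  by rewrite /D; field; rewrite !gt_eqF.
by rewrite divr_ge0 ?(ltW wx0)// subr_ge0 gibbs2.
Qed.

Lemma adjoined_entropy_nonincreasing (R : realType) (w l x y : R) :
  0 < w -> 0 < y -> y <= x -> l <= ln y ->
  adjoined_entropy w l x <= adjoined_entropy w l y.
Proof.
move=> w0 y0 yx ly; have x0 := lt_le_trans y0 yx.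
rewrite -subr_le0; apply: le_trans (adjoined_entropy_sub l w0 x0 y0) _.
rewrite mulr_le0_ge0 ?subr_ge0// subr_le0 ler_pM2l// lef_pV2 ?posrE ?addr_gt0//.
by rewrite lerD2l.
Qed.

Lemma adjoined_entropy_nondecreasing (R : realType) (w l x y : R) :
  0 < w -> 0 < y -> y <= x -> ln x <= l ->
  adjoined_entropy w l y <= adjoined_entropy w l x.
Proof.
move=> w0 y0 yx xl; have x0 := lt_le_trans y0 yx.
(* The roles are swapped: here the sign of [ln - l] is known at the larger point [x]. *)
rewrite -subr_le0; apply: le_trans (adjoined_entropy_sub l w0 y0 x0) _.
rewrite mulr_ge0_le0 ?subr_le0// subr_ge0 ler_pM2l// lef_pV2 ?posrE ?addr_gt0//.
by rewrite lerD2l.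
Qed.

(** The product [W L]. *)
Definition xlnx_sum (R : realType) (n : nat) : R :=
  \sum_(q <- primes n) (logn q n)%:R * ln (logn q n)%:R.

Lemma bigOmega_gt0 n : (2 <= n)%N -> (0 < bigOmega n)%N.
Proof.
move=> n2; have pn : pdiv n \in primes n by rewrite pi_pdiv.
by rewrite /bigOmega (big_rem _ pn) /= addn_gt0 logn_gt0 pn.
Qed.

(** Split each [ln (a / W)] as [ln a - ln W]; the weights [a / W] sum to 1. *)
Lemma entropyE (R : realType) n : (2 <= n)%N ->
  entropy R n = ln (bigOmega n)%:R - xlnx_sum R n / (bigOmega n)%:R.
Proof.
move=> n2; have W0 : 0 < (bigOmega n)%:R :> R by rewrite ltr0n bigOmega_gt0.
rewrite /entropy; set W := (bigOmega n)%:R in W0 *.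
rewrite [X in - X](_ : _ = xlnx_sum R n / W
    - (\sum_(q <- primes n) (logn q n)%:R) * (ln W / W)); last first.
  (* Membership in [primes n] is kept because splitting the logarithm requires a positive
     exponent. *)
  rewrite /xlnx_sum !mulr_suml -sumrB big_seq [RHS]big_seq.
  apply: eq_bigr => q qn.
  have a0 : 0 < (logn q n)%:R :> R by rewrite ltr0n logn_gt0.
  by rewrite ln_div ?posrE//; field; rewrite gt_eqF.
rewrite -natr_sum -/(bigOmega n) -/W.
by field; rewrite gt_eqF.
Qed.

Section AdjoinPrimePower.
Variables (n p x : nat).
Hypotheses (p_prime : prime p) (n_gt0 : (0 < n)%N) (x_gt0 : (0 < x)%N).
Hypothesis np_coprime : coprime n p.

Let pNn : p \notin primes n.
Proof.
by rewrite mem_primes p_prime n_gt0 /= -prime_coprime// coprime_sym.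
Qed.

Lemma perm_primesM_prime_exp : perm_eq (primes (n * p ^ x)) (p :: primes n).
Proof.
apply: uniq_perm; rewrite ?primes_uniq//= ?pNn ?primes_uniq// => q.
rewrite primesM ?expn_gt0 ?(prime_gt0 p_prime)// primesX//.
by rewrite (primes_prime p_prime) !inE orbC.
Qed.

Lemma lognM_prime_exp_self : logn p (n * p ^ x) = x.
Proof.
rewrite lognM ?expn_gt0 ?(prime_gt0 p_prime)// pfactorK//.
by move: pNn; rewrite -logn_gt0 lt0n negbK => /eqP ->.
Qed.

Lemma lognM_prime_exp_other q : q \in primes n -> logn q (n * p ^ x) = logn q n.
Proof.
move=> qn; rewrite lognM ?expn_gt0 ?(prime_gt0 p_prime)// lognX (logn_prime _ p_prime).
by case: eqP qn pNn => [-> ->//|_ _ _]; rewrite muln0 addn0.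
Qed.

(** A general monoid and a general [F] let one statement serve both the natural sum [bigOmega] and
    the real sum [xlnx_sum]. *)
Lemma big_primesM_prime_exp (T : Type) (idx : T) (op : Monoid.com_law idx)
    (F : nat -> T) :
  \big[op/idx]_(q <- primes (n * p ^ x)) F (logn q (n * p ^ x)) =
  op (F x) (\big[op/idx]_(q <- primes n) F (logn q n)).
Proof.
rewrite (perm_big _ perm_primesM_prime_exp) big_cons lognM_prime_exp_self.
congr (op _ _); rewrite big_seq [RHS]big_seq.
by apply: eq_bigr => q qn; rewrite lognM_prime_exp_other.
Qed.

End AdjoinPrimePower.

(** The new prime adds [x] to [bigOmega] and [x ln x] to [xlnx_sum]. *)
Lemma entropyM_prime_exp (R : realType) n p x :
  prime p -> (2 <= n)%N -> (0 < x)%N -> coprime n p ->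
  entropy R (n * p ^ x) =
  adjoined_entropy (bigOmega n)%:R (xlnx_sum R n / (bigOmega n)%:R) x%:R.
Proof.
move=> pp n2 x0 np; have n0 : (0 < n)%N by exact: ltnW.
rewrite entropyE; last first.
  by rewrite (leq_trans n2)// leq_pmulr// expn_gt0 prime_gt0.
rewrite {1 2}/bigOmega /xlnx_sum.
rewrite (big_primesM_prime_exp pp n0 x0 np _ id).
rewrite (big_primesM_prime_exp pp n0 x0 np _ (fun a => a%:R * ln a%:R)) /=.
rewrite -/(bigOmega n) -/(xlnx_sum R n) /adjoined_entropy natrD.
rewrite [x%:R + _]addrC [X in X / _]addrC mulrCA divff ?mulr1//.
by rewrite gt_eqF// ltr0n bigOmega_gt0.
Qed.

(** Exponentiate [- H n = L - ln W]; the factor [W] cancels. *)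
Lemma bigOmega_expR_entropy (R : realType) n : (2 <= n)%N ->
  (bigOmega n)%:R * expR (- entropy R n) =
  expR (xlnx_sum R n / (bigOmega n)%:R).
Proof.
move=> n2; have W0 : 0 < (bigOmega n)%:R :> R by rewrite ltr0n bigOmega_gt0.
by rewrite entropyE// opprB expRB lnK ?posrE// mulrC divfK// gt_eqF.
Qed.

Theorem proposition4p1 (R : realType) (alpha beta p n : nat)
    (alpha_ge1 : (1 <= alpha)%N) (beta_ge1 : (1 <= beta)%N)
    (p_prime : prime p) (n_ge2 : (2 <= n)%N) (np_coprime : gcdn n p = 1%N) :
  ((beta <= alpha)%N ->
     (bigOmega n)%:R * expR (- entropy R n) <= beta%:R ->
     entropy R (n * p ^ alpha)%N <= entropy R (n * p ^ beta)%N) /\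
  ((beta <= alpha)%N ->
     alpha%:R <= (bigOmega n)%:R * expR (- entropy R n) ->
     entropy R (n * p ^ beta)%N <= entropy R (n * p ^ alpha)%N).
Proof.
have cop : coprime n p by apply/eqP.
have W0 : 0 < (bigOmega n)%:R :> R by rewrite ltr0n bigOmega_gt0.
(* The threshold becomes [e^L], so taking logarithms compares [L] with [ln beta] in the first claim
   and with [ln alpha] in the second. *)
rewrite bigOmega_expR_entropy// !entropyM_prime_exp//.
split=> ba thr.
- apply: adjoined_entropy_nonincreasing; rewrite ?ltr0n ?ler_nat ?bigOmega_gt0//.
  by rewrite -ler_expR lnK// posrE ltr0n.
- apply: adjoined_entropy_nondecreasing; rewrite ?ltr0n ?ler_nat ?bigOmega_gt0//.
  by rewrite -ler_expR lnK// posrE ltr0n.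
Qed.
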